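(* Let $A$ be a continuous Scott domain with a countable basis $K$, and let $w:K\to[0,1]$ satisfy $w(\bot_A)=0$, $w(k)>0$ for $k\in K\setminus\{\bot_A\}$, and $\sum_{k\in K}w(k)=1$. For $K_0\subseteq K$ put $W(K_0)=\sum_{k\in K_0}w(k)$, and for $x\in A$ put $K_x=\{k\in K\mid k\ll x\}$ and $I_x=\{k\in K\mid k\sqcup x\text{ does not exist}\}$. Let $\rho(x,y)=[l(x,y),u(x,y)]$ be given by any one of the following: (i) $u(x,y)=1-W(K_x\cap K_y)$, $l(x,y)=0$; (ii) $u(x,y)=1-W(K_x\cap K_y)$, $l(x,y)=W(I_x\cup I_y)$; (iii) $u(x,y)=1-W(K_x\cap K_y)-W(I_x\cap I_y)$, $l(x,y)=W(K_x\cap I_y)+W(K_y\cap I_x)$. Then $u$ is a partial metric, $\rho:A\times A\to R^I$ is a Scott continuous relaxed metric, and the relaxed metric topology coincides with the Scott topology on $A$.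
   Context: Directed sets are nonempty. A dcpo is a poset with least element $\bot$ in which every directed subset has a least upper bound. $x\ll y$ means: for every directed $S$ with $y\sqsubseteq\sqcup S$ there is $s\in S$ with $x\sqsubseteq s$. A continuous dcpo with basis $K\subseteq A$: for every $a\in A$ the set $\{k\in K\mid k\ll a\}$ is directed with supremum $a$. A continuous Scott domain is a continuous dcpo in which every subset with an upper bound has a least upper bound. $U$ is Scott open if it is upward closed and meets every directed $S$ with $\sqcup S\in U$. Scott continuous means monotone and preserving directed suprema; $A\times A$ has the coordinatewise order. $R^I$ is the domain of intervals $[a,b]$ with $0\le a\le b\le+\infty$, ordered by $[a,b]\sqsubseteq[c,d]$ iff $a\le c$ and $d\le b$. $R^-$ is $[0,+\infty]$ ordered by $\sqsubseteq\,=\,\ge$. A symmetric $u:A\times A\to R^-$ is a relaxed metric if $u(x,z)\le u(x,y)+u(y,z)$; a symmetric $\rho=[l,u]:A\times A\to R^I$ is a relaxed metric if its upper part $u$ is. The relaxed metric topology: $U\subseteq A$ is open iff for each $x\in U$ there is a real $\epsilon>u(x,x)$ with $\{y\mid u(x,y)<\epsilon\}\subseteq U$. A partial metric on a partially ordered set is a function $p\geq 0$ with: $x=y$ iff $p(x,x)=p(x,y)=p(y,y)$; $p(x,x)\le p(x,y)$; $p(x,y)=p(y,x)$; $p(x,z)\le p(x,y)+p(y,z)-p(y,y)$; and moreover $p(x,x)=p(x,y)$ if $x\sqsubseteq y$, while $p(x,x)<p(x,y)$ if $x\not\sqsubseteq y$. *)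

(* Defs.v *)
From HB Require Import structures.
From mathcomp Require Import all_boot all_order all_algebra.
From mathcomp Require Import all_classical all_reals all_analysis.

Set Implicit Arguments.
Unset Strict Implicit.
Unset Printing Implicit Defensive.

Import Order.TTheory GRing.Theory Num.Theory.
Local Open Scope classical_set_scope.
Local Open Scope order_scope.

Definition directed d (T : porderType d) (S : set T) : Prop :=
  S !=set0 /\
  forall x y, S x -> S y -> exists z, [/\ S z, x <= z & y <= z].

(* The least element is part of bPOrderType. *)
Definition dcpo d (A : bPOrderType d) : Prop :=
  forall S : set A, directed S -> exists a, isLub S a.

Definition way_below d (T : porderType d) (x y : T) : Prop :=
  forall S a, directed S -> isLub S a -> y <= a -> exists2 s, S s & x <= s.

Definition basis_below d (T : porderType d) (K : set T) (x : T) : set T :=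
  [set k | K k /\ way_below k x].

Definition continuous_dcpo d (A : bPOrderType d) (K : set A) : Prop :=
  dcpo A /\
  forall a : A, directed (basis_below K a) /\ isLub (basis_below K a) a.

Definition continuous_scott_domain d (A : bPOrderType d) (K : set A) : Prop :=
  continuous_dcpo K /\
  forall S : set A, has_ubound S -> exists a, isLub S a.

Definition scott_topology d (T : porderType d) : set (set T) :=
  [set U | (forall x y, U x -> x <= y -> U y) /\
           (forall S a, directed S -> isLub S a -> U a -> S `&` U !=set0)].
Arguments scott_topology {d} T.

Definition scott_continuous d d' (T : porderType d) (T' : porderType d')
    (f : T -> T') : Prop :=
  {homo f : x y / x <= y} /\
  forall S a, directed S -> isLub S a -> isLub (f @` S) (f a).

Section IntervalDomain.
Variable R : realType.

Record RI := MkRI {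
  RI_bounds : \bar R * \bar R;
  RI_boundsP : (0 <= RI_bounds.1)%E && (RI_bounds.1 <= RI_bounds.2)%E }.

HB.instance Definition _ := [isSub for RI_bounds].
HB.instance Definition _ := [Choice of RI by <:].

Definition lower (i : RI) : \bar R := (RI_bounds i).1.
Definition upper (i : RI) : \bar R := (RI_bounds i).2.

(* Reverse inclusion of intervals. *)
Definition RI_le (i j : RI) : bool :=
  (lower i <= lower j)%E && (upper j <= upper i)%E.

Lemma RI_le_refl : reflexive RI_le.
Proof. by move=> i; rewrite /RI_le !lexx. Qed.

Lemma RI_le_anti : antisymmetric RI_le.
Proof.
move=> i j /andP[/andP[lij uij] /andP[lji uji]]; apply: val_inj.
rewrite [val i]surjective_pairing [val j]surjective_pairing.
by congr pair; apply: le_anti; rewrite ?lij ?uij ?lji ?uji.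
Qed.

Lemma RI_le_trans : transitive RI_le.
Proof.
move=> j i k /andP[lij uij] /andP[ljk ujk].
by rewrite /RI_le (le_trans lij ljk) (le_trans ujk uij).
Qed.

Fact RI_display : Order.disp_t. Proof. exact: Order.Disp tt tt. Qed.

HB.instance Definition _ :=
  Order.Le_isPOrder.Build RI_display RI RI_le_refl RI_le_anti RI_le_trans.

End IntervalDomain.

Local Open Scope ring_scope.

(* R^- is represented by the nonnegative elements of \bar R; its order >= is
   not involved here. *)
Definition upper_relaxed_metric (R : realType) (T : Type)
    (u : T -> T -> \bar R) : Prop :=
  [/\ forall x y, (0 <= u x y)%E,
      forall x y, u x y = u y x &
      forall x y z, (u x z <= u x y + u y z)%E].

Definition relaxed_metric (R : realType) (T : Type) (rho : T * T -> RI R) :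
    Prop :=
  (forall x y, rho (x, y) = rho (y, x)) /\
  upper_relaxed_metric (fun x y => upper (rho (x, y))).

Definition relaxed_metric_topology (R : realType) (T : Type)
    (rho : T * T -> RI R) : set (set T) :=
  [set U | forall x, U x -> exists eps : R,
     (upper (rho (x, x)) < eps%:E)%E /\
     [set y | (upper (rho (x, y)) < eps%:E)%E] `<=` U].

Definition partial_metric (R : realType) d (T : porderType d)
    (p : T -> T -> R) : Prop :=
  [/\ forall x y, 0 <= p x y,
      forall x y, x = y <-> p x x = p x y /\ p x y = p y y,
      forall x y, p x x <= p x y,
      forall x y, p x y = p y x &
      forall x y z, p x z <= p x y + p y z - p y y] /\
  forall x y, ((x <= y)%O -> p x x = p x y) /\ (~~ (x <= y)%O -> p x x < p x y).

(* The sum is finite whenever w is nonnegative on K with total weight 1 and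
   K0 is a subset of K, so that fine loses no information. *)
Definition weight (R : realType) (T : choiceType) (w : T -> R) (K0 : set T) :
    R :=
  fine (\esum_(k in K0) (w k)%:E).

Definition incompatible d (T : porderType d) (K : set T) (x : T) : set T :=
  [set k | K k /\ ~ exists z, isLub [set k; x] z].

(* Main.v *)
(** By interpolation and bounded completeness, [x |-> K_x] and [x |-> I_x]
    send directed suprema to unions. The weight [W], being a supremum of finite
    sums, turns such families of sets into lower semicontinuous functions, so
    that [l] and [-u] are lower semicontinuous: this is the continuity of [rho]
    and the Scott openness of the balls. The sharp triangle inequality is a
    Venn diagram count. Finally, passing from [u(x, x)] to [u(x, y)] costs
    nothing when [x] is below [y], and at least [w(k)] when [K_x] contains a [k]
    outside [K_y]; hence the ball of radius [u(x, x) + w(k)] at [x] lies above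
    [k]. *)
Require Import Defs.
From HB Require Import structures.
From mathcomp Require Import all_boot all_order all_algebra.
From mathcomp Require Import all_classical all_reals all_analysis.
From mathcomp Require Import lra.

Set Implicit Arguments.
Unset Strict Implicit.
Unset Printing Implicit Defensive.

Import Order.TTheory GRing.Theory Num.Theory.
Local Open Scope classical_set_scope.
Local Open Scope ring_scope.

(** * Scott open sets and their preimages *)

Section ScottOpen.
Variables (d : Order.disp_t) (T : porderType d).
Implicit Types U V : set T.

(** Openness is local: later proofs need only one open neighbourhood inside [U] at each point,
    without returning to directed sets. *)
Lemma scott_open_nbhs U :
  (forall x, U x -> exists V, [/\ scott_topology T V, V x & V `<=` U]) ->
  scott_topology T U.
Proof.
move=> Unbhs; split=> [x y /Unbhs[V [[Vup _] Vx VU]] xy|S a dS Sa].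
  exact/VU/(Vup x).
move=> /Unbhs[V [[_ Vmeet] Va VU]].
have [s [Ss Vs]] := Vmeet S a dS Sa Va.
by exists s; split=> //; exact: VU.
Qed.

Lemma scott_open_cst (P : Prop) : scott_topology T [set _ | P].
Proof. by split=> // S a [[s Ss] _] _ p; exists s. Qed.

Lemma scott_openI U V :
  scott_topology T U -> scott_topology T V -> scott_topology T (U `&` V).
Proof.
move=> [Uup Umeet] [Vup Vmeet]; split=> [x y [Ux Vx] xy|S a dS Sa [Ua Va]].
  by split; [exact: (Uup x)|exact: (Vup x)].
have [s [Ss Us]] := Umeet _ _ dS Sa Ua.
have [t [St Vt]] := Vmeet _ _ dS Sa Va.
have [r [Sr sr tr]] := dS.2 _ _ Ss St.
by exists r; split=> //; split; [exact: (Uup s)|exact: (Vup t)].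
Qed.

Lemma scott_openU U V :
  scott_topology T U -> scott_topology T V -> scott_topology T (U `|` V).
Proof.
move=> oU oV; apply: scott_open_nbhs => x [Ux|Vx].
  by exists U; split=> // y; left.
by exists V; split=> // y; right.
Qed.

End ScottOpen.

Lemma scott_open_preimage d d' (T : porderType d) (T' : porderType d')
    (f : T -> T') (U : set T') :
  scott_continuous f -> scott_topology T' U -> scott_topology T (f @^-1` U).
Proof.
move=> [fmono fsup] [Uup Umeet]; split=> [x y Ux xy|S a [[s0 Ss0] dS] Sa Ua].
  exact: (Uup (f x) _ Ux (fmono _ _ xy)).
have dfS : directed (f @` S).
  split=> [|_ _ [x Sx <-] [y Sy <-]]; first by exists (f s0), s0.
  have [z [Sz xz yz]] := dS _ _ Sx Sy.
  by exists (f z); split; [exists z|exact: fmono|exact: fmono].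
have [_ [[s Ss <-] Us]] := Umeet _ _ dfS (fsup S a (conj (ex_intro _ _ Ss0) dS) Sa) Ua.
by exists s.
Qed.

(** * Projections of the coordinatewise order *)

Section ProductProjections.
Variables (d : Order.disp_t) (A : porderType d).

Lemma scott_continuous_fst : scott_continuous (fst : A *p A -> A).
Proof.
split=> [x y|S a _ [ubSa lubSa]]; first by rewrite Order.ProdOrder.leEprod => /andP[].
split=> [_ [x Sx <-]|b bub].
  by have := ubSa x Sx; rewrite Order.ProdOrder.leEprod => /andP[].
(* Leastness of [a] is tested against [a] with its first coordinate replaced by [b]. *)
have /lubSa : ubound S ((b, a.2) : A *p A).
  move=> x Sx; rewrite Order.ProdOrder.leEprod /= bub /=; last by exists x.
  by have := ubSa x Sx; rewrite Order.ProdOrder.leEprod => /andP[].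
by rewrite Order.ProdOrder.leEprod => /andP[].
Qed.

Lemma scott_continuous_snd : scott_continuous (snd : A *p A -> A).
Proof.
split=> [x y|S a _ [ubSa lubSa]]; first by rewrite Order.ProdOrder.leEprod => /andP[].
split=> [_ [x Sx <-]|b bub].
  by have := ubSa x Sx; rewrite Order.ProdOrder.leEprod => /andP[].
have /lubSa : ubound S ((a.1, b) : A *p A).
  move=> x Sx; rewrite Order.ProdOrder.leEprod /= bub ?andbT //; last by exists x.
  by have := ubSa x Sx; rewrite Order.ProdOrder.leEprod => /andP[].
by rewrite Order.ProdOrder.leEprod => /andP[].
Qed.

End ProductProjections.

(* This is Scott continuity of [F] into the powerset ordered by inclusion. *)
Definition scott_open_family d (T : porderType d) (I : Type)
    (F : T -> set I) : Prop :=
  forall k, scott_topology T [set x | F x k].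

Definition scott_lsc (R : realType) d (T : porderType d) (f : T -> R) : Prop :=
  forall c, scott_topology T [set x | c < f x].

(** * Set-valued maps with Scott open fibres *)

Section OpenFamilies.
Variables (d : Order.disp_t) (T : porderType d) (I : choiceType).
Implicit Types F G : T -> set I.

Lemma scott_open_family_cst (X : set I) : scott_open_family (fun _ : T => X).
Proof. by move=> k; exact: scott_open_cst. Qed.

Lemma scott_open_familyI F G : scott_open_family F -> scott_open_family G ->
  scott_open_family (fun x => F x `&` G x).
Proof. by move=> oF oG k; exact: (scott_openI (oF k) (oG k)). Qed.

Lemma scott_open_familyU F G : scott_open_family F -> scott_open_family G ->
  scott_open_family (fun x => F x `|` G x).
Proof. by move=> oF oG k; exact: (scott_openU (oF k) (oG k)). Qed.

Lemma scott_open_family_comp d' (T' : porderType d') (f : T' -> T) F :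
  scott_continuous f -> scott_open_family F ->
  scott_open_family (fun x => F (f x)).
Proof. by move=> cf oF k; exact: (scott_open_preimage cf (oF k)). Qed.

Lemma scott_open_family_le F x y :
  scott_open_family F -> (x <= y)%O -> F x `<=` F y.
Proof. by move=> oF xy k Fxk; exact: ((oF k).1 x). Qed.

(** This is an intersection of open sets, one for each element of [X]; finiteness of [X] keeps it
    open. *)
Lemma scott_open_finite_sub F (X : set I) :
  scott_open_family F -> finite_set X ->
  scott_topology T [set x | X `<=` F x].
Proof.
move=> oF /finite_seqP[s ->]; elim: s => [|k s IHs].
  rewrite [X in scott_topology T X](_ : _ = [set _ | True]).
    exact: scott_open_cst.
  by apply/seteqP; split=> // x _ k.
rewrite [X in scott_topology T X](_ : _ = [set x | F x k] `&`
  [set x | [set` s] `<=` F x]); first exact: scott_openI.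
apply/seteqP; split=> [x /= sub|x [/= Fk sub] j].
  split; first by apply: sub; rewrite /= mem_head.
  by move=> j js; apply: sub; rewrite /= inE [_ \in _]js orbT.
by rewrite /= inE => /orP[/eqP->|/sub].
Qed.

End OpenFamilies.

(** * Lower semicontinuous real functions *)

Section LowerSemicontinuity.
Variables (R : realType) (d : Order.disp_t) (T : porderType d).
Implicit Types f g : T -> R.

Lemma scott_lsc_cst (c : R) : scott_lsc (fun _ : T => c).
Proof. by move=> c'; exact: scott_open_cst. Qed.

Lemma scott_lscD f g :
  scott_lsc f -> scott_lsc g -> scott_lsc (fun x => f x + g x).
Proof.
move=> lf lg c; apply: scott_open_nbhs => x /= cfg.
(* Half of the excess over [c], so that a loss below [e] in each summand keeps the sum above [c]. *)
pose e := (f x + g x - c) / 2.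
exists ([set y | f x - e < f y] `&` [set y | g x - e < g y]).
split; first exact: scott_openI.
  by split=> /=; rewrite /e; lra.
by move=> y [/=]; rewrite /e; lra.
Qed.

Lemma scott_lsc_le f x y : scott_lsc f -> (x <= y)%O -> f x <= f y.
Proof.
by move=> lf xy; rewrite leNgt; apply/negP => /((lf _).1 x y)/(_ xy)/=; rewrite ltxx.
Qed.

End LowerSemicontinuity.

(** * The weight as a measure of total mass one *)

Section Weight.
Variables (R : realType) (T : choiceType) (K : set T) (w : T -> R).
Hypothesis w_ge0 : forall k, K k -> 0 <= w k.
Hypothesis w_sum : (\esum_(k in K) (w k)%:E = 1)%E.
Local Notation W := (weight w).
Implicit Types X Y Z : set T.

Let wE_ge0 X : X `<=` K -> forall k, X k -> (0 <= (w k)%:E)%E.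
Proof. by move=> XK k /XK; rewrite lee_fin; exact: w_ge0. Qed.

Lemma esum_weight X : X `<=` K -> (\esum_(k in X) (w k)%:E)%E = (W X)%:E.
Proof.
move=> XK; rewrite fineK // ge0_fin_numE; last exact/esum_ge0/wE_ge0.
apply: (@le_lt_trans _ _ 1%E); last by rewrite ltry.
rewrite -w_sum (esumID X K) ?(setIidr XK); last exact: wE_ge0.
by rewrite leeDl //; apply: esum_ge0; apply: wE_ge0 => k [].
Qed.

Lemma weight_ge0 X : X `<=` K -> 0 <= W X.
Proof. by move=> XK; rewrite -lee_fin -esum_weight //; exact/esum_ge0/wE_ge0. Qed.

Lemma weightID X Y : X `<=` K -> W X = W (X `&` Y) + W (X `&` ~` Y).
Proof.
move=> XK; apply: EFin_inj.
rewrite EFinD -!esum_weight; [|by move=> k [/XK]..|by []].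
by apply: esumID; exact: wE_ge0.
Qed.

Lemma weight_le X Y : Y `<=` K -> X `<=` Y -> W X <= W Y.
Proof.
move=> YK XY; rewrite (weightID X YK) (setIidr XY) lerDl.
by apply: weight_ge0 => k [/YK].
Qed.

Lemma weight_setT : W K = 1. Proof. by rewrite /weight w_sum. Qed.

Lemma weight_set0 : W set0 = 0. Proof. by rewrite /weight esum_set0. Qed.

Lemma weight_set1 k : K k -> W [set k] = w k.
Proof. by move=> Kk; rewrite /weight esum_set1 // lee_fin w_ge0. Qed.

Lemma weight_disjointD_le X Y Z : Z `<=` K -> X `<=` Z -> Y `<=` Z ->
  X `&` Y = set0 -> W X + W Y <= W Z.
Proof.
move=> ZK XZ YZ XY0; rewrite (weightID X ZK) (setIidr XZ) lerD2l.
apply: weight_le => [k [/ZK]//|k Yk]; split; first exact: YZ.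
by move=> Xk; suff : (X `&` Y) k by rewrite XY0.
Qed.

(** Split [X] ∩ [Y] and [Y] along [Z]: the part of [X] ∩ [Y] inside [Z] lies in [X] ∩ [Z], the part
    outside lies in [Y] minus [Z], and [Y] ∩ [Z] cancels. *)
Lemma weightI_triangle X Y Z : X `<=` K -> Y `<=` K ->
  W (X `&` Y) + W (Y `&` Z) <= W (X `&` Z) + W Y.
Proof.
move=> XK YK.
have XYK : X `&` Y `<=` K by move=> k [/XK].
rewrite (weightID Z XYK) (weightID Z YK).
have : W (X `&` Y `&` Z) <= W (X `&` Z).
  by apply: weight_le => [k [/XK]|k [[]]].
have : W (X `&` Y `&` ~` Z) <= W (Y `&` ~` Z).
  by apply: weight_le => [k [/YK]|k [[]]].
lra.
Qed.

(** The singleton of [k] and [X] ∩ [Y] are disjoint parts of [X]. *)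
Lemma weightI_add_le X Y k : X `<=` K -> X k -> ~ Y k ->
  W (X `&` Y) + w k <= W X.
Proof.
move=> XK Xk nYk; rewrite -weight_set1; last exact: XK.
apply: weight_disjointD_le => [//|j []//|j ->//|].
by apply/seteqP; split=> // j [[_ Yj] jk]; apply: nYk; rewrite -jk.
Qed.

Lemma weight_finite_approx X c : X `<=` K -> c < W X ->
  exists Y, [/\ finite_set Y, Y `<=` X & c < W Y].
Proof.
move=> XK cX.
have Xfin : (\esum_(k in X) (w k)%:E)%E \is a fin_num by rewrite esum_weight.
have e_gt0 : 0 < W X - c by rewrite subr_gt0.
(* The sum over [X] is a supremum of finite sums, so some finite sum is within [W X - c] of it. *)
have [_ [Y [finY YX] <-]] := ub_ereal_sup_adherent e_gt0 Xfin.
rewrite -/(esum X _) esum_weight // -esum_fset //; last first.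
  by move=> i /set_mem /YX /XK; rewrite lee_fin; exact: w_ge0.
rewrite esum_weight; last by move=> k /YX /XK.
rewrite -EFinB lte_fin => cY; exists Y; split=> //.
by move: cY; lra.
Qed.

(** A finite part of [F x] already weighs more than [c], and containing that part is an open
    condition. *)
Lemma scott_lsc_weight d (S : porderType d) (F : S -> set T) :
  (forall x, F x `<=` K) -> scott_open_family F ->
  scott_lsc (fun x => W (F x)).
Proof.
move=> FK oF c; apply: scott_open_nbhs => x /(weight_finite_approx (FK x)).
move=> [X [finX XF cX]]; exists [set y | X `<=` F y].
split=> //; first exact: scott_open_finite_sub.
by move=> y /= XFy; apply: (lt_le_trans cX); apply: weight_le.
Qed.

End Weight.

(** * Way-below sets and incompatible sets in a continuous Scott domain *)

Section ScottDomain.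
Variables (d : Order.disp_t) (A : bPOrderType d) (K : set A).
Hypothesis A_domain : continuous_scott_domain K.
Local Notation K_ := (basis_below K).
Local Notation I_ := (incompatible K).

Lemma way_below_le (x y : A) : way_below x y -> (x <= y)%O.
Proof.
move=> xy; have [s ->//] : exists2 s, [set y] s & (x <= s)%O.
apply: (xy [set y] y) => //.
  by split=> [|_ _ -> ->]; exists y.
by split=> [_ ->//|b]; apply.
Qed.

Lemma way_below_le_trans (x y z : A) :
  way_below x y -> (y <= z)%O -> way_below x z.
Proof. by move=> xy yz S a dS Sa za; apply: (xy S a) => //; exact: le_trans za. Qed.

Lemma basis_below_sub x : K_ x `<=` K. Proof. by move=> k []. Qed.

Lemma incompatible_sub x : I_ x `<=` K. Proof. by move=> k []. Qed.

(* Interpolation: if [k] is way below [sup S], then it lies below an element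
   of the directed union of the [K_ s], hence it is way below some [s]. *)
Lemma basis_below_open : scott_open_family K_.
Proof.
move=> k; split=> [x y [Kk kx] xy|S a dS Sa [Kk ka]].
  by split=> //; exact: way_below_le_trans xy.
have Kdir s : directed (K_ s) by case: (A_domain.1.2 s).
have Klub s : isLub (K_ s) s by case: (A_domain.1.2 s).
have KS s t : (s <= t)%O -> K_ s `<=` K_ t.
  by move=> st j [Kj js]; split=> //; exact: way_below_le_trans st.
have dU : directed (\bigcup_(s in S) K_ s).
  have [[s Ss] Sdir] := dS; split.
    by have [[j js] _] := Kdir s; exists j, s.
  move=> i j [t St it] [r Sr jr].
  have [q [Sq tq rq]] := Sdir _ _ St Sr.
  have [m [mq im jm]] := (Kdir q).2 _ _ (KS _ _ tq _ it) (KS _ _ rq _ jr).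
  by exists m; split=> //; exists q.
have lubU : isLub (\bigcup_(s in S) K_ s) a.
  split=> [j [s Ss [_ /way_below_le js]]|b bub].
    exact: le_trans js (Sa.1 s Ss).
  apply: Sa.2 => s Ss; apply: (Klub s).2 => j js.
  by apply: bub; exists s.
have [j [s Ss [_ js]] kj] := ka _ _ dU lubU (lexx a).
exists s; split=> //; split=> // S' a' dS' Sa' sa'.
have [t St jt] := js S' a' dS' Sa' sa'.
by exists t => //; exact: le_trans jt.
Qed.

(** Bounded completeness turns any common upper bound into a join, so incompatibility means the
    absence of upper bounds. *)
Lemma incompatibleP k x :
  I_ x k <-> K k /\ ~ exists b, (k <= b)%O /\ (x <= b)%O.
Proof.
split=> -[Kk nb]; split=> // -[b]; last first.
  by move=> [bub _]; apply: nb; exists b; split; apply: bub; [left|right].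
move=> [kb xb]; apply: nb; apply: A_domain.2.
by exists b => y [->|->].
Qed.

(* If [k] is compatible with every member of the directed set [S], then the
   joins of [k] with these members form a directed set, whose supremum bounds
   both [k] and [sup S]. *)
Lemma incompatible_open : scott_open_family I_.
Proof.
move=> k; split=> [x y /incompatibleP[Kk nb] xy|S a dS Sa /incompatibleP[Kk nb]].
  apply/incompatibleP; split=> // -[b [kb yb]]; apply: nb.
  by exists b; split=> //; exact: le_trans yb.
apply: contrapT => nS; apply: nb.
have join s : S s -> exists z, isLub [set k; s] z.
  by move=> Ss; apply: contrapT => nz; apply: nS; exists s.
pose D := [set z | exists2 s, S s & isLub [set k; s] z].
have [[s0 Ss0] Sdir] := dS.
have D_dir : directed D.
  split; first by have [z lz] := join _ Ss0; exists z, s0.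
  move=> x y [s Ss xlub] [t St ylub].
  have [r [Sr sr tr]] := Sdir _ _ Ss St.
  have [z zlub] := join r Sr.
  have kz : (k <= z)%O by apply: zlub.1; left.
  have rz : (r <= z)%O by apply: zlub.1; right.
  exists z; split; first by exists r.
    by apply: xlub.2 => _ [->//|->]; exact: le_trans rz.
  by apply: ylub.2 => _ [->//|->]; exact: le_trans rz.
have [b [bub _]] := A_domain.1.1 D D_dir.
exists b; split.
  have [z zlub] := join _ Ss0.
  by apply: le_trans (bub z _); [apply: zlub.1; left|exists s0].
apply: Sa.2 => s Ss; have [z zlub] := join _ Ss.
by apply: le_trans (bub z _); [apply: zlub.1; right|exists s].
Qed.

Lemma basis_below_incompatible_disjoint x : K_ x `&` I_ x = set0.
Proof.
apply/seteqP; split=> // k [[_ /way_below_le kx] /incompatibleP[_]]; apply.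
by exists x.
Qed.

(** Otherwise [y] would bound [K_ x], whose supremum is [x]. The witness avoids bottom so that it
    has positive weight. *)
Lemma not_le_basis_below x y :
  ~~ (x <= y)%O -> exists k, [/\ K_ x k, ~ K_ y k & k <> \bot%O].
Proof.
move=> xy; apply: contrapT => nk; move/negP: xy; apply.
apply: (A_domain.1.2 x).2.2 => k kx.
have [->|/eqP kbot] := eqVneq k \bot%O; first exact: le0x.
by apply: contrapT => ky; apply: nk; exists k; split=> // -[_ /way_below_le].
Qed.

Lemma scott_open_basis (U : set A) x : scott_topology A U -> U x ->
  exists k, K_ x k /\ U k.
Proof.
move=> [_ Umeet]; have [Kdir Klub] := A_domain.1.2 x.
by move=> /(Umeet _ _ Kdir Klub)[k [Kxk Uk]]; exists k.
Qed.

End ScottDomain.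

(** * The upper part [u], uniformly in the three cases *)

Section RelaxedMetric.
Variables (R : realType) (d : Order.disp_t) (A : bPOrderType d) (K : set A).
Variable w : A -> R.
Hypothesis A_domain : continuous_scott_domain K.
Hypothesis w_ge0 : forall k, K k -> 0 <= w k.
Hypothesis w_pos : forall k, K k -> k <> \bot%O -> 0 < w k.
Hypothesis w_sum : (\esum_(k in K) (w k)%:E = 1)%E.
Local Notation W := (weight w).
Local Notation K_ := (basis_below K).

(* [J] is empty in cases (i) and (ii), and [incompatible K] in case (iii). *)
Variable J : A -> set A.
Hypothesis J_sub : forall x, J x `<=` K.
Hypothesis J_open : scott_open_family J.
Hypothesis J_disjoint : forall x, K_ x `&` J x = set0.

Variable u : A -> A -> R.
Hypothesis uE : forall x y, u x y = 1 - W (K_ x `&` K_ y) - W (J x `&` J y).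

Let K_sub x : K_ x `<=` K. Proof. exact: basis_below_sub. Qed.

(** The two subtracted weights belong to disjoint subsets of [K], which has weight 1. *)
Lemma upper_ge0 x y : 0 <= u x y.
Proof.
rewrite uE -addrA -opprD subr_ge0 -(weight_setT w_sum).
apply: (weight_disjointD_le w_ge0 w_sum) => //.
- by move=> k [/K_sub].
- by move=> k [/J_sub].
- apply/seteqP; split=> // k [[kx _] [jx _]].
  by suff : (K_ x `&` J x) k by rewrite J_disjoint.
Qed.

Lemma upperC x y : u x y = u y x.
Proof. by rewrite !uE setIC (setIC (J x)). Qed.

Lemma upper_self_le x y : u x x <= u x y.
Proof.
rewrite !uE !setIid.
have := weight_le w_ge0 w_sum (K_sub (x:=x)) (@subIsetl _ (K_ x) (K_ y)).
have := weight_le w_ge0 w_sum (J_sub (x:=x)) (@subIsetl _ (J x) (J y)).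
lra.
Qed.

(** Both families grow along the order, so the intersections collapse to [K_ x] and [J x]. *)
Lemma upper_self_eq x y : (x <= y)%O -> u x x = u x y.
Proof.
move=> xy; rewrite !uE !setIid (setIidl (scott_open_family_le J_open xy)).
by rewrite (setIidl (scott_open_family_le (basis_below_open A_domain) xy)).
Qed.

Lemma upper_add_le x y k : K_ x k -> ~ K_ y k -> u x x + w k <= u x y.
Proof.
move=> kx nky; rewrite !uE !setIid.
have := weightI_add_le w_ge0 w_sum (K_sub (x:=x)) kx nky.
have := weight_le w_ge0 w_sum (J_sub (x:=x)) (@subIsetl _ (J x) (J y)).
lra.
Qed.

Lemma upper_self_lt x y : ~~ (x <= y)%O -> u x x < u x y.
Proof.
move=> /(not_le_basis_below A_domain)[k [kx nky kbot]].
by have := upper_add_le kx nky; have := w_pos (K_sub kx) kbot; lra.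
Qed.

(** The sum of [weightI_triangle] for the sets [K_] and for the sets [J]. *)
Lemma upper_triangle x y z : u x z <= u x y + u y z - u y y.
Proof.
rewrite !uE !setIid.
have := weightI_triangle w_ge0 w_sum (K_ z) (K_sub (x:=x)) (K_sub (x:=y)).
have := weightI_triangle w_ge0 w_sum (J z) (J_sub (x:=x)) (J_sub (x:=y)).
lra.
Qed.

Lemma upper_partial_metric : partial_metric u.
Proof.
split; last by move=> x y; split; [exact: upper_self_eq|exact: upper_self_lt].
split; [exact: upper_ge0| |exact: upper_self_le|exact: upperC|
  exact: upper_triangle].
(* Equal self-distances exclude the strict inequality of [upper_self_lt] both ways, so antisymmetry
   applies. *)
move=> x y; split=> [->//|[uxx uyy]]; apply/eqP; rewrite eq_le.
apply/andP; split; apply/negPn/negP => /upper_self_lt.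
  by rewrite uxx ltxx.
by rewrite -uyy upperC ltxx.
Qed.

(** The maps [f] and [g] cover both uses: one argument fixed for balls, and the two projections for
    joint continuity. *)
Lemma scott_lsc_opp_upper d' (T : porderType d') (f g : T -> A) :
  scott_open_family (fun t => K_ (f t)) ->
  scott_open_family (fun t => K_ (g t)) ->
  scott_open_family (fun t => J (f t)) ->
  scott_open_family (fun t => J (g t)) ->
  scott_lsc (fun t => - u (f t) (g t)).
Proof.
move=> oKf oKg oJf oJg; under eq_fun do rewrite uE !opprB.
apply: scott_lscD; last (apply: scott_lscD; last exact: scott_lsc_cst).
  apply: (scott_lsc_weight w_ge0 w_sum) => [t k [/J_sub//]|].
  exact: scott_open_familyI.
apply: (scott_lsc_weight w_ge0 w_sum) => [t k [/K_sub//]|].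
exact: scott_open_familyI.
Qed.

Lemma upper_ball_open x eps : scott_topology A [set y | u x y < eps].
Proof.
have lsc : scott_lsc (fun y => - u x y).
  apply: scott_lsc_opp_upper => //; try exact: scott_open_family_cst.
  exact: basis_below_open.
have := lsc (- eps); congr scott_topology.
by apply/funext => y /=; rewrite ltrN2.
Qed.

Lemma upper_topology :
  [set U | forall x, U x ->
    exists eps, u x x < eps /\ [set y | u x y < eps] `<=` U] = scott_topology A.
Proof.
apply/seteqP; split=> U.
  move=> oU; apply: scott_open_nbhs => x /oU[eps [xeps ballU]].
  by exists [set y | u x y < eps]; split=> //; exact: upper_ball_open.
move=> oU x /(scott_open_basis A_domain oU)[k [kx Uk]].
have Uup y : (k <= y)%O -> U y by exact: oU.1.
(* Bottom carries no guarantee of positive weight, but if [k] is bottom then [U] is everything and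
   any radius above [u x x] will do. *)
have [kbot|/eqP kbot] := eqVneq k \bot%O.
  exists (u x x + 1); split; first by lra.
  by move=> y _; apply: Uup; rewrite kbot le0x.
exists (u x x + w k); split; first by have := w_pos (K_sub kx) kbot; lra.
move=> y /= uxy; apply/Uup/way_below_le; apply: contrapT => nky.
have : ~ K_ y k by case.
by move/(upper_add_le kx); lra.
Qed.

(** * The interval-valued map *)

Variable l : A -> A -> R.
Hypothesis l_ge0 : forall x y, 0 <= l x y.
Hypothesis l_le_u : forall x y, l x y <= u x y.
Hypothesis lC : forall x y, l x y = l y x.
Hypothesis l_lsc : scott_lsc (fun p : A *p A => l p.1 p.2).

Lemma interval_of_subproof (p : A *p A) :
  (0 <= ((l p.1 p.2)%:E, (u p.1 p.2)%:E).1 <=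
    ((l p.1 p.2)%:E, (u p.1 p.2)%:E).2)%E.
Proof. by rewrite /= !lee_fin l_ge0 l_le_u. Qed.

Definition interval_of (p : A *p A) : RI R := MkRI (interval_of_subproof p).

Lemma interval_of_scott_continuous : scott_continuous interval_of.
Proof.
have oK := basis_below_open A_domain.
have u_lsc : scott_lsc (fun p : A *p A => - u p.1 p.2).
  by apply: scott_lsc_opp_upper; apply: scott_open_family_comp => //;
    (exact: scott_continuous_fst || exact: scott_continuous_snd).
have mono : {homo interval_of : x y / (x <= y)%O}.
  move=> p q pq; apply/andP; rewrite /lower /upper /= !lee_fin.
  by split; [exact: (scott_lsc_le l_lsc)|rewrite -lerN2; exact: (scott_lsc_le u_lsc)].
split=> // S a dS Sa; split=> [_ [p Sp <-]|b bub]; first exact/mono/Sa.1.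
have bS p : S p -> (lower (interval_of p) <= lower b)%E /\
    (upper b <= upper (interval_of p))%E.
  by move=> Sp; apply/andP; apply: (bub (interval_of p)); exists p.
have /andP[b_ge0 _] : (0 <= lower b <= upper b)%E := RI_boundsP b.
have lu_b : (lower b <= upper b)%E by case/andP: (RI_boundsP b).
have [s0 Ss0] := dS.1.
(* If an endpoint of [b] failed to bound that of [interval_of a], semicontinuity would yield a [p]
   in [S] whose endpoint already fails in the same way, against [bS]. *)
apply/andP; rewrite !leNgt; split; apply/negP.
  case: (lower b) b_ge0 bS => [c _ bS||] //.
  rewrite lte_fin => /((l_lsc c).2 S a dS Sa)[p [Sp /= cp]].
  by have [] := bS p Sp; rewrite lee_fin leNgt cp.
case: (upper b) (le_trans b_ge0 lu_b) bS => [c _ bS|_ bS|] //.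
  rewrite lte_fin -ltrN2 => /((u_lsc (- c)).2 S a dS Sa)[p [Sp /=]].
  by rewrite ltrN2 => cp; have [_] := bS p Sp; rewrite lee_fin leNgt cp.
(* An infinite [upper b] cannot lie below the real upper endpoint at [s0]. *)
by have [] := bS s0 Ss0.
Qed.

Lemma interval_of_relaxed_metric : relaxed_metric interval_of.
Proof.
split=> [x y|].
  by apply: val_inj; rewrite /= lC upperC.
split=> [x y|x y|x y z]; rewrite /upper /= ?lee_fin ?upper_ge0 //.
  by rewrite upperC.
(* The relaxed inequality drops the nonnegative term [u y y] from the sharp one. *)
by have := upper_triangle x y z; have := upper_ge0 y y; lra.
Qed.

Lemma interval_of_topology :
  relaxed_metric_topology interval_of = scott_topology A.
Proof. by rewrite -upper_topology. Qed.

Lemma relaxed_metric_theorem :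
  partial_metric u /\
  exists rho : A *p A -> RI R,
    [/\ forall x y, lower (rho (x, y)) = (l x y)%:E /\
                    upper (rho (x, y)) = (u x y)%:E,
        scott_continuous rho,
        relaxed_metric rho &
        relaxed_metric_topology rho = scott_topology A].
Proof.
split; first exact: upper_partial_metric.
exists interval_of; split=> //.
- exact: interval_of_scott_continuous.
- exact: interval_of_relaxed_metric.
- exact: interval_of_topology.
Qed.

End RelaxedMetric.

Theorem theorem10p6p1 (R : realType) (d : Order.disp_t) (A : bPOrderType d)
    (K : set A) (w : A -> R) (l u : A -> A -> R)
    (A_domain : continuous_scott_domain K)
    (K_countable : countable K)
    (w_itv : forall k, K k -> 0 <= w k <= 1)
    (w_bot : w \bot%O = 0)
    (w_pos : forall k, K k -> k <> \bot%O -> 0 < w k)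
    (w_sum : (\esum_(k in K) (w k)%:E = 1)%E)
    (W := weight w)
    (K_ := basis_below K)
    (I_ := incompatible K)
    (lu_def :
      [\/ forall x y, u x y = 1 - W (K_ x `&` K_ y) /\
                      l x y = 0,
          forall x y, u x y = 1 - W (K_ x `&` K_ y) /\
                      l x y = W (I_ x `|` I_ y)
        | forall x y, u x y = 1 - W (K_ x `&` K_ y) - W (I_ x `&` I_ y) /\
                      l x y = W (K_ x `&` I_ y) + W (K_ y `&` I_ x)]) :
  partial_metric u /\
  exists rho : A *p A -> RI R,
    [/\ forall x y, lower (rho (x, y)) = (l x y)%:E /\
                    upper (rho (x, y)) = (u x y)%:E,
        scott_continuous rho,
        relaxed_metric rho &
        relaxed_metric_topology rho = scott_topology A].
Proof.
have w_ge0 k : K k -> 0 <= w k by move=> /w_itv/andP[].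
have K_sub x : K_ x `<=` K := @basis_below_sub _ _ _ x.
have I_sub x : I_ x `<=` K := @incompatible_sub _ _ _ x.
have KI0 x : K_ x `&` I_ x = set0.
  exact: basis_below_incompatible_disjoint.
have notKI x k : K_ x k -> I_ x k -> False.
  by move=> kx ix; suff : (K_ x `&` I_ x) k by rewrite KI0.
have oK : scott_open_family K_ := basis_below_open A_domain.
have oI : scott_open_family I_ := incompatible_open A_domain.
have oK1 := scott_open_family_comp (@scott_continuous_fst _ A) oK.
have oK2 := scott_open_family_comp (@scott_continuous_snd _ A) oK.
have oI1 := scott_open_family_comp (@scott_continuous_fst _ A) oI.
have oI2 := scott_open_family_comp (@scott_continuous_snd _ A) oI.
have le1 X Y : X `<=` K -> Y `<=` K -> X `&` Y = set0 -> W X + W Y <= 1.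
  by rewrite -(weight_setT w_sum); exact: (weight_disjointD_le w_ge0 w_sum).
have KK_sub x y : K_ x `&` K_ y `<=` K by move=> k [/K_sub].
have KI_sub x y : K_ x `&` I_ y `<=` K by move=> k [/K_sub].
have IU_sub x y : I_ x `|` I_ y `<=` K by move=> k [/I_sub|/I_sub].
have W0 : W (set0 `&` set0) = 0 by rewrite setI0; exact: weight_set0.
case: lu_def => lu.
- apply: (relaxed_metric_theorem A_domain w_ge0 w_pos w_sum (J := fun=> set0)).
  + by move=> x; exact: sub0set.
  + exact: scott_open_family_cst.
  + by move=> x; rewrite setI0.
  + by move=> x y; rewrite -/W W0 subr0 (lu x y).1.
  + by move=> x y; rewrite (lu x y).2.
  + move=> x y; rewrite (lu x y).1 (lu x y).2 subr_ge0.
    by rewrite -(weight_setT w_sum); exact: (weight_le w_ge0 w_sum).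
  + by move=> x y; rewrite !(lu _ _).2.
  + under eq_fun do rewrite (lu _ _).2.
    exact: scott_lsc_cst.
- apply: (relaxed_metric_theorem A_domain w_ge0 w_pos w_sum (J := fun=> set0)).
  + by move=> x; exact: sub0set.
  + exact: scott_open_family_cst.
  + by move=> x; rewrite setI0.
  + by move=> x y; rewrite -/W W0 subr0 (lu x y).1.
  + by move=> x y; rewrite (lu x y).2; exact: (weight_ge0 w_ge0 w_sum).
  (* An element of [K_ x] ∩ [K_ y] is compatible with both points, so this set misses [I_ x] ∪
     [I_ y]. *)
  + move=> x y; rewrite (lu x y).1 (lu x y).2 lerBrDr; apply: le1 => //.
    by apply/seteqP; split=> // k [[ix|iy] [kx ky]]; [exact: notKI ix|exact: notKI iy].
  + by move=> x y; rewrite !(lu _ _).2 setUC.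
  + under eq_fun do rewrite (lu _ _).2.
    apply: (scott_lsc_weight w_ge0 w_sum) => //; exact: scott_open_familyU.
- apply: (relaxed_metric_theorem A_domain w_ge0 w_pos w_sum (J := I_)) => [//|//|//|||||].
  + by move=> x y; rewrite (lu x y).1.
  + by move=> x y; rewrite (lu x y).2 addr_ge0 //; exact: (weight_ge0 w_ge0 w_sum).
  + move=> x y; rewrite (lu x y).1 (lu x y).2.
    (* The four weights are grouped in disjoint pairs, one inside [K_ x] and one inside [I_ x];
       these two sets are themselves disjoint, so the total is at most 1. *)
    have leK : W (K_ x `&` K_ y) + W (K_ x `&` I_ y) <= W (K_ x).
      apply: (weight_disjointD_le w_ge0 w_sum) => [//|k []//|k []//|].
      by rewrite setIACA KI0 setI0.
    have leI : W (I_ x `&` I_ y) + W (K_ y `&` I_ x) <= W (I_ x).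
      apply: (weight_disjointD_le w_ge0 w_sum) => [//|k []//|k []//|].
      by apply/seteqP; split=> // k [[_ iy] [ky _]]; exact: notKI iy.
    have := le1 _ _ (K_sub x) (I_sub x) (KI0 x).
    lra.
  + by move=> x y; rewrite !(lu _ _).2 addrC.
  + under eq_fun do rewrite (lu _ _).2.
    by apply: scott_lscD; apply: (scott_lsc_weight w_ge0 w_sum) => //;
      exact: scott_open_familyI.
Qed.
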